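(* The density of states measure $\nu$ of an ergodic family of extended pCMV matrices is log-Hölder continuous. That is, there exists a constant $c>0$ for which $$\nu(A)\le -c\,\big(\log \mathrm{Leb}(A)\big)^{-1}$$ for every arc $A\subseteq\partial\mathbb D$ with $\mathrm{Leb}(A)<1/2$, where $\mathrm{Leb}$ denotes the arc length measure on $\partial\mathbb D$ (so $\mathrm{Leb}(\partial\mathbb D)=2\pi$).
   Context: Let $\mathbb D=\{z\in\mathbb C:|z|<1\}$ and let $\partial\mathbb D$ be the unit circle. For $\alpha\in\mathbb D$, $\lambda\in\partial\mathbb D$ put $$\Theta(\alpha,\lambda)=\lambda\begin{bmatrix}\overline\alpha&\rho\\ \rho&-\alpha\end{bmatrix},\qquad \rho=\sqrt{1-|\alpha|^2}.$$ Given a sequence $\{(\alpha_n,\lambda_n)\}_{n\in\mathbb Z}\in(\mathbb D\times\partial\mathbb D)^{\mathbb Z}$, define unitary operators on $\ell^2(\mathbb Z)$ by $\mathcal L=\bigoplus_{j\in\mathbb Z}\Theta(\alpha_{2j},\lambda_{2j})$ and $\mathcal M=\bigoplus_{j\in\mathbb Z}\Theta(\alpha_{2j+1},\lambda_{2j+1})$, where $\Theta(\alpha_k,\lambda_k)$ acts on $\ell^2(\{k,k+1\})$. The (extended) phased CMV (pCMV) matrix with these coefficients is $\mathcal E_{\alpha,\lambda}=\mathcal L\mathcal M$. Density of states measure: given such an operator $\mathcal E$, let $\mathcal E^{(n)}_{\mathrm D}=\chi_n\mathcal E\chi_n^*$ be its restriction to a finite box with Dirichlet boundary conditions, where $\chi_n:\ell^2(\mathbb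 Z)\to\ell^2([-n,n]\cap\mathbb Z)$ is the canonical projection. Then $\mathcal E^{(n)}_{\mathrm D}$ has $2n+1$ eigenvalues counting multiplicities; let $\nu_n$ be the normalized eigenvalue counting measure. If $\nu_n$ has a weak$^*$ limit as $n\to\infty$, this limit is denoted $\nu$ and called the density of states measure of $\mathcal E$. Ergodic family: $S:\Omega\to\Omega$ is an invertible bi-measurable transformation of a Borel probability space $\Omega$, $\mu$ is an $S$-ergodic measure, $f:\Omega\to\mathbb D$ and $g:\Omega\to\partial\mathbb D$ are measurable, and there is a constant $C<1$ with $|f|\le C$ $\mu$-almost everywhere. The family is $\mathcal E(\omega)=\mathcal E_{\alpha(\omega),\lambda(\omega)}$, $\omega\in\Omega$, with $\alpha_n(\omega)=f(S^n\omega)$, $\lambda_n(\omega)=g(S^n\omega)$, $n\in\mathbb Z$. The density of states measure $\nu$ of the family is the density of states measure of $\mathcal E(\omega)$ for $\mu$-a.e. $\omega$. *)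

(* Defs.v *)
From HB Require Import structures.
From mathcomp Require Import all_boot all_order all_algebra.
From mathcomp Require Import all_classical all_reals all_analysis.
From mathcomp Require Import complex.
Import Order.TTheory GRing.Theory Num.Theory.
Import numFieldNormedType.Exports.

Set Implicit Arguments.
Unset Strict Implicit.
Unset Printing Implicit Defensive.

Local Open Scope classical_set_scope.
Local Open Scope ring_scope.
Local Open Scope complex_scope.

(** The complex numbers are [R[i]], over an arbitrary model [R : realType] of
    the reals. MathComp-Analysis puts the norm topology of a numeric field [K]
    on the alias [K^o]; [borel R[i]^o] is therefore C with its Borel sets. *)
Notation borel T := (@g_sigma_algebraType T (@open _)).

Section Operators.
Variable R : realType.
Local Notation C := R[i].
Implicit Types (alpha lambda u : int -> C) (E : (int -> C) -> int -> C).

(** [Num.sqrt] and [`|_|] are those of the field C, so [rho] is the nonnegative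
    real sqrt (1 - |a|^2) when |a| < 1. *)
Definition Theta_rho (a : C) : C := sqrtC (1 - `|a| ^+ 2).

Definition Theta (a l : C) : 'M[C]_2 :=
  l *: \matrix_(i, j)
    if i == 0 then (if j == 0 then a^* else Theta_rho a)
              else (if j == 0 then Theta_rho a else - a).

(** [blocks p] is the direct sum over j in Z of the operators
    Theta(alpha_k, lambda_k), k = 2j + p, acting on the span of delta_k and
    delta_(k+1). For a given m, the block containing the index m starts at
    [k = p + 2 * ((m - p) %/ 2)] and m sits in it at position
    [(m - p) %% 2]. Every entry of the image only involves two entries of [u],
    so the formula makes sense for all sequences; on l^2(Z) it is the unitary
    operator given by the direct sum. *)
Definition blocks (p : int) alpha lambda u : int -> C := fun m =>
  let k := p + ((m - p) %/ 2)%Z * 2 in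
  let i : 'I_2 := inord `|((m - p) %% 2)%Z|%N in
  \sum_(j < 2) Theta (alpha k) (lambda k) i j * u (k + j%:Z).

Definition pCMV_L := blocks 0.
Definition pCMV_M := blocks 1.

Definition pCMV alpha lambda u : int -> C :=
  pCMV_L alpha lambda (pCMV_M alpha lambda u).

(** Coordinates of the box [-n, n]: the index [i : 'I_(2n+1)] stands for the
    site [i - n]. *)
Definition box_proj n u : 'cV[C]_(n.*2.+1) := \col_i u (i%:Z - n%:Z).

Definition box_incl n (v : 'cV[C]_(n.*2.+1)) : int -> C := fun m =>
  \sum_(i < n.*2.+1 | i%:Z - n%:Z == m) v i 0.

(** The matrix of [v |-> box_proj n (E (box_incl n v))] in the standard
    basis. *)
Definition dirichlet E n : 'M[C]_(n.*2.+1) :=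
  \matrix_(i, j) box_proj n (E (box_incl (delta_mx j 0))) i 0.

(** The eigenvalues repeated according to algebraic multiplicity. *)
Definition eigenvalues N (A : 'M[C]_N) : seq C :=
  sval (closed_field_poly_normal (char_poly A)).

(** The n-th normalized eigenvalue counting measure, as a measure on C: the
    truncation of a unitary operator is only a contraction, so its eigenvalues
    lie in the closed unit disk but in general not on the circle. *)
Definition counting_measure E n : {measure set (borel C^o) -> \bar R} :=
  mscale ((n.*2.+1)%:R^-1)%:nng
    (msum (fun i => dirac ((eigenvalues (dirichlet E n))`_i : borel C^o))
      n.*2.+1).

(** All the counting measures are carried by the closed unit disk, hence testing
    against bounded continuous functions on C is the same as testing against
    continuous functions on that disk. *)
Definition weak_star_limit (nun : nat -> {measure set (borel C^o) -> \bar R})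
    (nu : {measure set (borel C^o) -> \bar R}) :=
  forall h : C^o -> R, continuous h -> bounded_fun h ->
    (fun n => \int[nun n]_z (h z)%:E)%E @ \oo --> (\int[nu]_z (h z)%:E)%E.

Definition is_dos_measure E (nu : {measure set (borel C^o) -> \bar R}) :=
  weak_star_limit (counting_measure E) nu.

End Operators.

Section Ergodic.
Variables (R : realType) (d : measure_display) (T : measurableType d).

Definition ergodic (mu : probability T R) (S : T -> T) :=
  [/\ measurable_fun setT S,
      forall A, measurable A -> mu (S @^-1` A) = mu A
    & forall A, measurable A -> S @^-1` A = A -> mu A = 0%E \/ mu A = 1%E].

(** [iterz S S' n] is the n-th power of a bijection [S] with inverse [S']. *)
Definition iterz (S S' : T -> T) (n : int) : T -> T :=
  match n with
  | Posz k => iter k S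
  | Negz k => iter k.+1 S'
  end.

End Ergodic.

Section Circle.
Variable R : realType.

Definition cis (t : R) : R[i] := cos t +i* sin t.

(** Degenerate arcs (the empty set, single points) are allowed. They have length
    0, and as [ln 0 = 0] and [0^-1 = 0], a bound [nu A <= - c * (ln 0)^-1] reads
    [nu A <= 0], which agrees with the convention 1 / log 0 = 0. *)
Definition is_arc (A : set R[i]) :=
  exists2 I : set R, is_interval I & A = cis @` I.

(** Arc length, total mass [2 * pi]. *)
Definition Leb (A : set R[i]) : \bar R :=
  lebesgue_measure (`[0, 2 * pi[ `&` cis @^-1` A).

End Circle.

(* Main.v *)
Require Import Defs.
From HB Require Import structures.
From mathcomp Require Import all_boot all_order all_algebra.
From mathcomp Require Import all_classical all_reals all_analysis.
From mathcomp Require Import complex.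
From mathcomp Require Import measurable_realfun.
From mathcomp Require Import ring lra zify.
Import Order.TTheory GRing.Theory Num.Theory.
Import numFieldNormedType.Exports.

Set Implicit Arguments.
Unset Strict Implicit.
Unset Printing Implicit Defensive.

(** Fix a realization with [|alpha_n| <= c0 < 1] for all [n]. Growing a box by
    one site, the characteristic polynomial of the truncated pCMV matrix obeys a
    Szego recursion, which for [|z| >= 1] gives
    [|det (z - E_n)| >= (1 - c0) ^ (2n + 1)], as in the Craig-Simon argument.
    So the eigenvalues [w] of [E_n] lie in the open disk and the average of
    [log (3 / |z - w|)] over them is at most [log 3 - log (1 - c0)], uniformly
    in [n] and in [z] on the circle. After truncation of the logarithm this
    passes to the weak limit, and Markov's inequality bounds the mass that [nu]
    gives to the disk of radius [d] about [z] by
    [(log 3 - log (1 - c0)) / log (3 / d)]. An arc of length [l] lies in such a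
    disk with [d = 2 l]. *)

Local Open Scope ring_scope.

(** * The characteristic polynomial of a truncation *)

Section Determinant.
Variable K : comNzRingType.

(** Only row 0 of [z%:M - X b *m Y] depends on [b], through [- b] times row 0 of [Y]. By
    multilinearity in that row, the coefficient [Q] is the determinant with row 0 of [Y] put in its
    place. *)
Lemma det_cut_row N (X : K -> 'M[K]_N.+1) (Y : 'M[K]_N.+1) (z P Q : K) :
  (forall b, row 0 (X b) = b *: delta_mx 0 0) ->
  (forall b, row' 0 (X b) = row' 0 (X 0)) ->
  (forall b, \det (z%:M - X b *m Y) = P - b * Q) ->
  forall b (V : 'M[K]_N.+1), row 0 V = row 0 Y ->
    row' 0 V = row' 0 (z%:M - X b *m Y) -> \det V = Q.
Proof.
move=> X0 X' D b V V0 V'.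
have rowM c : row' 0 (X c *m Y) = row' 0 (X c) *m Y.
  by apply/matrixP => i j; rewrite !mxE; apply: eq_bigr => k _; rewrite !mxE.
have rowB (A B : 'M[K]_N.+1) : row' 0 (A - B) = row' 0 A - row' 0 B.
  by apply/matrixP => i j; rewrite !mxE.
rewrite (@determinant_multilinear K _ V (z%:M - X 0 *m Y) (z%:M - X 1 *m Y)
  0 1 (- 1)).
- by rewrite !D; ring.
- rewrite !linearB /= !row_mul !X0 V0 scale0r mul0mx !scale1r scaleN1r.
  by rewrite -rowE subr0 addrA subrr sub0r scaleN1r opprK.
- by rewrite V' !rowB !rowM (X' b) ?(X' 1).
- by rewrite V' !rowB !rowM (X' b) ?(X' 1).
Qed.

(** Expansion along the first column, which has two nonzero entries. The corner has cofactor
    [P - t11 * Q]; the other minor carries [- t01] times row 0 of [Y] above the remaining rows of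
    [W], so it equals [- t01 * Q] by [det_cut_row]. *)
Lemma det_extend N (X : K -> 'M[K]_N.+1) (Y : 'M[K]_N.+1)
    (z P Q t00 t01 t11 b : K) :
  (forall b, row 0 (X b) = b *: delta_mx 0 0) ->
  (forall b, row' 0 (X b) = row' 0 (X 0)) ->
  (forall b, \det (z%:M - X b *m Y) = P - b * Q) ->
  \det (z%:M - (block_mx t00%:M (t01 *: delta_mx 0 0) (t01 *: delta_mx 0 0)
                  (X t11) : 'M[K]_(1 + N.+1)) *m block_mx b%:M 0 0 Y) =
  z * (P - t11 * Q) - b * (t00 * P + (t01 ^+ 2 - t00 * t11) * Q).
Proof.
move=> X0 X' D.
set W := z%:M - X t11 *m Y.
pose V : 'M[K]_N.+1 := \matrix_(i, j) if i == 0 then Y 0 j else W i j.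
have detV : \det V = Q.
  apply: (det_cut_row X0 X' D (b := t11)).
    by apply/rowP => j; rewrite !mxE.
  by apply/matrixP => i j; rewrite !mxE.
rewrite mulmx_block !mulmx0 !add0r !addr0.
have -> : z%:M = block_mx z%:M 0 0 z%:M :> 'M[K]_(1 + N.+1).
  by rewrite -scalar_mx_block.
rewrite opp_block_mx add_block_mx !sub0r -/W.
set A := block_mx _ _ _ _.
pose c : 'I_(1 + N.+1) := lshift N.+1 0.
have lift0 k : lift c k = rshift 1 k by apply/val_inj.
rewrite (expand_det_col _ c) (bigD1 c) //= (bigD1 (rshift 1 0)) //=.
rewrite big1 ?addr0; last first.
  move=> i /andP[]; case: (split_ordP i) => {}i ->; first by rewrite ord1 eqxx.
  rewrite eq_rshift => _ i0.
  by rewrite /A block_mxEdl !mxE big_ord1 !mxE (negPf i0) mulr0 mul0r oppr0 mul0r.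
rewrite /A block_mxEdl block_mxEul -/A !mxE !big_ord1 !mxE /= !mulr1n.
rewrite /cofactor /= addn0 expr0 mul1r addn0 expr1.
have -> : row' c (col' c A) = W.
  by apply/matrixP => i j; rewrite 2!mxE !lift0 /A block_mxEdr.
have lift1 : lift (rshift 1 0) 0 = c by apply/val_inj.
have lift2 k : lift (rshift 1 0) (lift 0 k) = rshift 1 (lift 0 k) :> 'I_(1 + N.+1).
  by apply/val_inj.
rewrite (@determinant_multilinear K _ (row' (rshift 1 0) (col' c A)) V V
  0 (- t01) 0).
- by rewrite detV /W D; ring.
- apply/rowP => j; do 3 rewrite [LHS]mxE.
  by rewrite lift0 lift1 block_mxEur -scalemxAl -rowE !mxE /= mul0r addr0 mulNr.
- apply/matrixP => i j; do 3 rewrite [RHS]mxE.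
  by rewrite lift0 lift2 block_mxEdr !mxE.
- apply/matrixP => i j; do 3 rewrite [RHS]mxE.
  by rewrite lift0 lift2 block_mxEdr !mxE.
Qed.

(** * Truncated direct sums of 2 x 2 blocks *)

Variables t00 t01 t11 : int -> K.

(** The matrix of the direct sum of the blocks
    [[t00 k, t01 k], [t01 k, t11 k]] on {k, k+1}, k ranging over the integers
    whose parity is [e]. *)
Definition block_entry (e : bool) (m m' : int) : K :=
  if odd `|m|%N == e then t00 m *+ (m' == m) + t01 m *+ (m' == m + 1)
  else t01 (m - 1) *+ (m' == m - 1) + t11 (m - 1) *+ (m' == m).

Lemma odd_abszD1 (m : int) : odd `|(m + 1)%R|%N = ~~ odd `|m|%N.
Proof. lia. Qed.

Lemma block_entryC e m m' : block_entry e m m' = block_entry e m' m.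
Proof.
rewrite /block_entry.
have [->//|nmm] := eqVneq m m'.
rewrite !mulr0n !addr0 !add0r.
have [->|nm1] := eqVneq m' (m + 1).
  rewrite odd_abszD1 addrK eqxx (_ : (m + 1 == m - 1) = false); last lia.
  by rewrite (_ : (m == m + 1 + 1) = false) ?mulr0n; last lia; case: odd e => -[].
rewrite (_ : (m == m' - 1) = false); last lia.
rewrite (_ : (m == m' + 1) = (m' == m - 1)); last lia.
have [->|nm2] := eqVneq m' (m - 1); last by do 2 case: ifP.
rewrite (_ : odd `|(m - 1)%R|%N = ~~ odd `|m|%N); last lia.
by rewrite !mulr0n; case: odd e => -[].
Qed.

(* The box [a, a + N] cuts the blocks of the parity of [a - 1] at its left end,
   which leaves the corner entry [b]. *)
Definition cut_mx a N b : 'M[K]_N.+1 := \matrix_(i, j)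
  if (i == 0) && (j == 0) then b
  else block_entry (~~ odd `|a|%N) (a + i%:Z) (a + j%:Z).

Definition full_mx a N : 'M[K]_N.+1 := \matrix_(i, j)
  block_entry (odd `|a|%N) (a + i%:Z) (a + j%:Z).

Lemma cut_mxT a N b : (cut_mx a N b)^T = cut_mx a N b.
Proof. by apply/matrixP => i j; rewrite !mxE andbC block_entryC. Qed.

Lemma full_mxT a N : (full_mx a N)^T = full_mx a N.
Proof. by apply/matrixP => i j; rewrite !mxE block_entryC. Qed.

Lemma row0_cut_mx a N b : row 0 (cut_mx a N b) = b *: delta_mx 0 0.
Proof.
apply/rowP => j; rewrite !mxE /=; case: eqVneq => [|j0]; first by rewrite mulr1.
rewrite mulr0 /block_entry addr0 (_ : (_ == ~~ _) = false); last first.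
  by case: odd.
have {}j0 : (j != 0 :> nat) by [].
rewrite (_ : (a + j%:Z == a - 1) = false); last lia.
by rewrite (_ : (a + j%:Z == a) = false) ?addr0 //; lia.
Qed.

Lemma row'0_cut_mx a N b : row' 0 (cut_mx a N b) = row' 0 (cut_mx a N 0).
Proof. by apply/matrixP => i j; rewrite !mxE. Qed.

(** The cut leaves the first site decoupled, and whole blocks start at the next one: removing a site
    turns a cut matrix into a full one. *)
Lemma cut_mxS a N b :
  cut_mx a N.+1 b = block_mx b%:M 0 0 (full_mx (a + 1) N) :> 'M[K]_(1 + N.+1).
Proof.
have C0 (j : 'I_N.+1) :
    cut_mx a N.+1 b (lshift N.+1 (0 : 'I_1)) (rshift 1 j) = 0.
  have /rowP/(_ (rshift 1 j)) := row0_cut_mx a N.+1 b.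
  rewrite [X in X = _]mxE [X in _ = X]mxE [X in _ = _ * X]mxE andbF mulr0 => <-.
  by congr (cut_mx a N.+1 b _ _); apply/val_inj.
apply/matrixP => i j.
case: (split_ordP i) => {}i ->; case: (split_ordP j) => {}j ->.
- by rewrite block_mxEul !ord1 !mxE.
- by rewrite block_mxEur ord1 C0 mxE.
- by rewrite block_mxEdl ord1 -cut_mxT [LHS]mxE C0 mxE.
- rewrite block_mxEdr !mxE /= odd_abszD1.
  by congr block_entry; rewrite PoszD addrA.
Qed.

(** The block on [a] and [a + 1] reaches the smaller box only at its first site, where it leaves the
    corner entry [t11 a]. *)
Lemma full_mxS a N :
  full_mx a N.+1 = block_mx (t00 a)%:M (t01 a *: delta_mx 0 0)
    (t01 a *: delta_mx 0 0) (cut_mx (a + 1) N (t11 a)) :> 'M[K]_(1 + N.+1).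
Proof.
have row0 (j : 'I_N.+1) :
    block_entry (odd `|a|%N) a (a + 1 + j%:Z) = t01 a *+ (j == 0).
  rewrite /block_entry eqxx (_ : (a + 1 + j%:Z == a) = false); last lia.
  by rewrite add0r (_ : (_ == a + 1) = (j == 0)) // -val_eqE /=; lia.
apply/matrixP => i j.
case: (split_ordP i) => {}i ->; case: (split_ordP j) => {}j ->.
- rewrite block_mxEul !ord1 !mxE /= addr0 /block_entry !eqxx.
  by rewrite (_ : (a == a + 1) = false) ?addr0 //; lia.
- rewrite block_mxEur ord1 !mxE /= addr0 PoszD addrA row0.
  by case: eqP; rewrite ?(mulr1, mulr0).
- rewrite block_mxEdl ord1 !mxE /= addr0 PoszD addrA block_entryC row0.
  by rewrite andbT; case: eqP; rewrite ?(mulr1, mulr0).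
- rewrite block_mxEdr !mxE /= !PoszD !addrA odd_abszD1 negbK.
  case: ifP => // /andP[/eqP-> /eqP->] /=.
  rewrite /block_entry addr0 odd_abszD1 addrK eqxx (_ : (_ == odd _) = false).
    by rewrite (_ : (a + 1 == a) = false) ?add0r //; lia.
  by case: odd.
Qed.

(** Both factors are symmetric, so transposition reverses their product. This compensates the
    exchange of the two factors each time the box grows. *)
Lemma det_cut_mulC a N b z :
  \det (z%:M - full_mx a N *m cut_mx a N b) =
  \det (z%:M - cut_mx a N b *m full_mx a N).
Proof.
by rewrite -det_tr linearB /= tr_scalar_mx trmx_mul cut_mxT full_mxT.
Qed.

Lemma det_cut_mxS a N z P Q :
  (forall b, \det (z%:M - cut_mx (a + 1) N b *m full_mx (a + 1) N) =
             P - b * Q) ->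
  forall b, \det (z%:M - cut_mx a N.+1 b *m full_mx a N.+1) =
    z * (P - t11 a * Q)
      - b * (t00 a * P + (t01 a ^+ 2 - t00 a * t11 a) * Q).
Proof.
move=> D b; rewrite -det_cut_mulC full_mxS cut_mxS.
by apply: det_extend D; [apply: row0_cut_mx|apply: row'0_cut_mx].
Qed.

End Determinant.

(** * The Szego recursion and its lower bound *)

Section Szego.
Variable K : numClosedFieldType.

(** The difference of the squared norms is [(1 - |al|^2) (|P|^2 - |Q|^2)], so one recursion step
    preserves the order of [|Q|] and [|P|]. *)
Lemma szego_norm_le (al l P Q : K) : `|l| = 1 -> `|al| <= 1 -> `|Q| <= `|P| ->
  `|l * (al^* * P + l * Q)| <= `|P + l * al * Q|.
Proof.
move=> l1 al1 QP; rewrite normrM l1 mul1r -ler_sqr ?nnegrE // -subr_ge0.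
rewrite !normCK !rmorphD !rmorphM /= conjCK.
have ll : l * l^* = 1 by rewrite -normCK l1 expr1n.
rewrite (_ : _ - _ = (1 - al * al^*) * (P * P^* - l * l^* * (Q * Q^*)));
  last by ring.
rewrite ll mul1r -!normCK mulr_ge0 // subr_ge0 ?exprn_ile1 //.
by rewrite ler_sqr ?nnegrE.
Qed.

Lemma szego_norm_ge (al l P Q c : K) : `|l| = 1 -> `|al| <= c -> `|Q| <= `|P| ->
  (1 - c) * `|P| <= `|P + l * al * Q|.
Proof.
move=> l1 alc QP.
have := lerB_dist P (- (l * al * Q)); rewrite opprK; apply: le_trans.
rewrite normrN !normrM l1 mul1r mulrBl mul1r lerB //.
by apply: ler_pM.
Qed.

Variables (alpha lambda rho : int -> K) (c : K).
Hypothesis lambda1 : forall n, `|lambda n| = 1.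
Hypothesis alphac : forall n, `|alpha n| <= c.
Hypothesis c1 : c < 1.
Hypothesis rhoE : forall n, rho n ^+ 2 = 1 - `|alpha n| ^+ 2.

Local Notation t00 := (fun n => lambda n * (alpha n)^*).
Local Notation t01 := (fun n => lambda n * rho n).
Local Notation t11 := (fun n => - (lambda n * alpha n)).
Local Notation cut := (cut_mx t00 t01 t11).
Local Notation full := (full_mx t00 t01 t11).

(* As a function of the corner entry [b], the determinant is [P - b * Q], and
   extending the box by one site acts on [(P, Q)] as a Szego transfer matrix. *)
Lemma szego_pair z : 1 <= `|z| -> forall N a, exists P Q,
  [/\ forall b, \det (z%:M - cut a N b *m full a N) = P - b * Q,
      `|Q| <= `|P| & (1 - c) ^+ N <= `|P|].
Proof.
move=> z1; have c0 : 0 <= c by apply: le_trans (alphac 0).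
elim=> [|N IH] a.
  (* On a single site the determinant is [z - b * t00 a]. *)
  exists z, (t00 a); split => [b||]; last by rewrite expr0.
    rewrite det_mx11 !mxE big_ord1 !mxE /= mulr1n /block_entry addr0 !eqxx.
    by rewrite (_ : (a == a + 1) = false) ?addr0 //; lia.
  rewrite normrM lambda1 mul1r norm_conjC.
  by rewrite (le_trans (alphac a)) // (le_trans (ltW c1)).
have [P [Q [D QP cP]]] := IH (a + 1).
(* The pair given by [det_cut_mxS]: by [rhoE], [t01 a ^+ 2 - t00 a * t11 a] equals
   [lambda a ^+ 2]. *)
exists (z * (P - t11 a * Q)), (lambda a * ((alpha a)^* * P + lambda a * Q)).
have -> : P - t11 a * Q = P + lambda a * alpha a * Q by ring.
have QP' := @szego_norm_le (alpha a) (lambda a) P Q (lambda1 a)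
  (le_trans (alphac a) (ltW c1)) QP.
split => [b||].
- rewrite (det_cut_mxS D) exprMn rhoE normCK; ring.
- by rewrite [in leRHS]normrM (le_trans QP') // ler_peMl.
- rewrite normrM exprS.
  apply: (@le_trans _ _ ((1 - c) * `|P|)).
    by rewrite ler_wpM2l // subr_ge0 ltW.
  apply: (le_trans (szego_norm_ge (lambda1 a) (alphac a) QP)).
  by rewrite ler_peMl.
Qed.

(** The corner entry acts as one more Szego step, with coefficient [- b] and phase 1, and costs one
    more factor [1 - c]. *)
Lemma norm_det_cut_ge z a N b : 1 <= `|z| -> `|b| <= c ->
  (1 - c) ^+ N.+1 <= `|\det (z%:M - cut a N b *m full a N)| /\
  (1 - c) ^+ N.+1 <= `|\det (z%:M - full a N *m cut a N b)|.
Proof.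
move=> z1 bc; rewrite det_cut_mulC.
suff D : (1 - c) ^+ N.+1 <= `|\det (z%:M - cut a N b *m full a N)| by [].
have [P [Q [-> QP cP]]] := szego_pair z1 N a.
have := @szego_norm_ge (- b) 1 P Q c; rewrite normrN normr1 mul1r mulNr.
move=> /(_ erefl bc QP); apply: le_trans.
by rewrite exprS ler_wpM2l // subr_ge0 ltW.
Qed.

End Szego.

Local Open Scope complex_scope.

(** * Truncated pCMV matrices and their eigenvalues *)

Section Truncation.
Variable R : realType.
Local Notation C := R[i].
Variables alpha lambda : int -> C.

Local Notation t00 := (fun n => lambda n * (alpha n)^*%R).
Local Notation t01 := (fun n => lambda n * Theta_rho (alpha n)).
Local Notation t11 := (fun n => - (lambda n * alpha n)).
Local Notation entry := (block_entry t00 t01 t11).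

Lemma blocksE (e : bool) (u : int -> C) m : blocks e%:Z alpha lambda u m =
  if odd `|m|%N == e then t00 m * u m + t01 m * u (m + 1)
  else t01 (m - 1) * u (m - 1) + t11 (m - 1) * u m.
Proof.
rewrite /blocks; case: eqVneq => me.
  have -> : ((m - e%:Z) %% 2)%Z = 0 by lia.
  have -> : e%:Z + ((m - e%:Z) %/ 2)%Z * 2 = m by lia.
  have -> : inord `|0|%N = ord0 :> 'I_2 by apply/val_inj; rewrite /= inordK.
  by rewrite !big_ord_recl big_ord0 !mxE /= !addr0.
have -> : ((m - e%:Z) %% 2)%Z = 1 by lia.
have -> : e%:Z + ((m - e%:Z) %/ 2)%Z * 2 = m - 1 by lia.
have -> : inord `|1|%N = lift ord0 ord0 :> 'I_2.
  by apply/val_inj; rewrite /= inordK.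
rewrite !big_ord_recl big_ord0 !mxE /= !addr0.
by rewrite (_ : m - 1 + _ = m) ?mulrN //; rewrite /bump /=; lia.
Qed.

Lemma box_incl_delta n (j : 'I_(n.*2.+1)) m :
  box_incl (delta_mx j 0) m = (j%:Z - n%:Z == m)%:R :> C.
Proof.
rewrite /box_incl; case: eqVneq => [<-|jm].
  rewrite (bigD1 j) //= big1 ?addr0 ?mxE ?eqxx // => i /andP[_ ij].
  by rewrite mxE (negPf ij).
rewrite big1 // => i /eqP im; rewrite mxE.
by case: eqVneq im => // -> /eqP; rewrite (negPf jm).
Qed.

Lemma blocks_delta (e : bool) n (j : 'I_(n.*2.+1)) m :
  blocks e%:Z alpha lambda (box_incl (delta_mx j 0)) m = entry e m (j%:Z - n%:Z).
Proof. by rewrite blocksE !box_incl_delta /block_entry !mulr_natr. Qed.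

(** Truncation loses the term at [x] when [x] leaves the box, which is harmless if [G] vanishes
    there. *)
Lemma sum_box a N (t : C) x (G : int -> C) :
  (~~ (a <= x <= a + N%:Z) -> G x = 0) ->
  \sum_(k < N.+1) (t *+ (x == a + k%:Z)) * G (a + k%:Z) = t * G x.
Proof.
have [/andP[ax xa] _|xa ->//] := boolP (a <= x <= _).
  have kN : (`|(x - a)%R|%N < N.+1)%N by lia.
  have xE : x = a + `|(x - a)%R|%N by lia.
  rewrite (bigD1 (Ordinal kN)) //= -xE eqxx big1 ?addr0 // => k kx.
  rewrite (_ : (x == _) = false) ?mul0r //; apply: contraNF kx => /eqP kx.
  by apply/eqP/val_inj; rewrite /= kx; lia.
rewrite mulr0 big1 // => k _; rewrite (_ : (x == _) = false) ?mul0r //.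
by have := ltn_ord k; lia.
Qed.

Lemma entry_outside e m m' : odd `|m|%N == e ->
  ~~ (m <= m' <= m + 1) -> entry e m m' = 0.
Proof.
rewrite /block_entry => -> mm; rewrite (_ : (m' == m) = false); last lia.
by rewrite (_ : (m' == m + 1) = false) ?addr0 //; lia.
Qed.

Lemma entry_outsideN e m m' : odd `|m|%N != e ->
  ~~ (m - 1 <= m' <= m) -> entry e m m' = 0.
Proof.
rewrite /block_entry => /negPf-> mm; rewrite (_ : (m' == m) = false); last lia.
by rewrite (_ : (m' == m - 1) = false) ?addr0 //; lia.
Qed.

Definition block_mx_box e n : 'M[C]_(n.*2.+1) :=
  \matrix_(i, j) entry e (- n%:Z + i%:Z) (- n%:Z + j%:Z).

(* A site outside the box that a block of L joins to the box is joined by M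
   only to sites outside the box, so truncation commutes with the product. *)
Lemma dirichlet_pCMV n : dirichlet (pCMV alpha lambda) n =
  block_mx_box false n *m block_mx_box true n.
Proof.
apply/matrixP => i j; rewrite !mxE /pCMV /pCMV_L /pCMV_M.
have M m : blocks 1 alpha lambda (box_incl (delta_mx j 0)) m =
    entry true m (- n%:Z + j%:Z) by rewrite addrC -(blocks_delta true).
rewrite (blocksE false) !M [i%:Z - _]addrC.
set m := - n%:Z + i%:Z; set m' := - n%:Z + j%:Z.
under [RHS]eq_bigr do rewrite !mxE -/m -/m' {1}/block_entry.
have im : - n%:Z <= m <= - n%:Z + (n.*2)%:Z by have := ltn_ord i; lia.
have jm : - n%:Z <= m' <= - n%:Z + (n.*2)%:Z by have := ltn_ord j; lia.
case: eqVneq => me.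
  under [RHS]eq_bigr do rewrite mulrDl eq_sym [_ == m + 1]eq_sym.
  rewrite big_split /= !(@sum_box _ _ _ _ (fun x => entry true x m')) //.
    by move=> mn; apply: entry_outside; lia.
  by move=> mn; lia.
under [RHS]eq_bigr do rewrite mulrDl eq_sym [_ == m]eq_sym.
rewrite big_split /= !(@sum_box _ _ _ _ (fun x => entry true x m')) //.
  by move=> mn; lia.
by move=> mn; apply: entry_outsideN; lia.
Qed.

Lemma Theta_rho_sqr (a : C) : Theta_rho a ^+ 2 = 1 - `|a| ^+ 2.
Proof. by rewrite /Theta_rho sqrtCK. Qed.

(** The parity of [n] decides which of L and M is cut at the left end of the box, hence the order of
    the cut and the full factor. The cut block leaves the corner entry [t11 (a - 1)], of norm at
    most [c]. *)
Lemma norm_det_dirichlet_ge (c : C) n (z : C) :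
  (forall k, `|lambda k| = 1) -> (forall k, `|alpha k| <= c) -> c < 1 ->
  1 <= `|z| ->
  (1 - c) ^+ n.*2.+1 <= `|\det (z%:M - dirichlet (pCMV alpha lambda) n)|.
Proof.
move=> l1 alc c1 z1.
pose a := - n%:Z.
have bc : `|t11 (a - 1)| <= c by rewrite normrN normrM l1 mul1r.
have fullE : block_mx_box (odd `|a|%N) n = full_mx t00 t01 t11 a n.*2.
  by apply/matrixP => i j; rewrite !mxE.
have cutE : block_mx_box (~~ odd `|a|%N) n = cut_mx t00 t01 t11 a n.*2 (t11 (a - 1)).
  apply/matrixP => i j; rewrite !mxE; case: ifP => // /andP[/eqP-> /eqP->].
  rewrite /= addr0 /block_entry -/a (_ : (_ == ~~ _) = false); last by case: odd.
  by rewrite eqxx (_ : (a == a - 1) = false) ?add0r //; lia.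
have := norm_det_cut_ge l1 alc c1 (fun k => Theta_rho_sqr (alpha k)) a n.*2 z1 bc.
rewrite dirichlet_pCMV; case: (odd _) fullE cutE => fullE cutE.
  by rewrite -fullE -cutE => -[D _]; exact: D.
by rewrite -fullE -cutE => -[_ D]; exact: D.
Qed.

Lemma char_polyE N (A : 'M[C]_N) :
  char_poly A = \prod_(w <- eigenvalues A) ('X - w%:P).
Proof.
rewrite /eigenvalues; case: (closed_field_poly_normal _) => s /= sE.
by rewrite {1}sE (monicP (char_poly_monic A)) scale1r.
Qed.

Lemma prod_eigenvalues N (A : 'M[C]_N) z :
  \prod_(w <- eigenvalues A) (z - w) = \det (z%:M - A).
Proof.
have -> : \det (z%:M - A) = (char_poly A).[z].
  rewrite /char_poly -[_.[z]]/(horner_eval z _) -det_map_mx; congr (\det _).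
  apply/matrixP => i j; rewrite !mxE.
  transitivity (('X *+ (i == j) - (A i j)%:P).[z]) => //.
  by rewrite hornerD hornerN hornerMn hornerX hornerC.
rewrite char_polyE horner_prod.
by apply: eq_bigr => w _; rewrite hornerXsubC.
Qed.

Lemma size_eigenvalues N (A : 'M[C]_N) : size (eigenvalues A) = N.
Proof.
by have := size_char_poly A; rewrite char_polyE size_prod_XsubC => -[].
Qed.

End Truncation.

Local Open Scope classical_set_scope.
Local Open Scope ring_scope.
Local Open Scope complex_scope.
Local Notation normc := ComplexField.Normc.normc.

(** * The logarithmic potential of the density of states *)

Section Borel.

Lemma open_borel (T : ptopologicalType) (A : set T) :
  open A -> measurable (A : set (borel T)).
Proof. exact: sub_sigma_algebra. Qed.

Lemma closed_borel (T : ptopologicalType) (A : set T) :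
  closed A -> measurable (A : set (borel T)).
Proof. by move=> /closed_openC/open_borel/measurableC; rewrite setCK. Qed.

Lemma continuous_borel (T : ptopologicalType) (R : realType) (f : T -> R) :
  continuous f -> measurable_fun setT (f : borel T -> R).
Proof.
move=> /continuousP cf.
apply: (measurability _ (RGenOpens.measurableE R)).
move=> _ [_ [a [b ->] <-]]; rewrite setTI; apply: open_borel; apply: cf.
exact: interval_open.
Qed.

End Borel.

Section NormC.
Variable R : realType.
Local Notation C := R[i].
Implicit Types z w : C.

Lemma norm_normc z : `|z| = (normc z)%:C. Proof. by []. Qed.

Lemma normc_prod (s : seq C) (F : C -> C) :
  normc (\prod_(w <- s) F w) = \prod_(w <- s) normc (F w).
Proof.
exact: (big_morph _ (@ComplexField.Normc.normcM R) (ComplexField.Normc.normc1 R)).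
Qed.

Lemma ler_normc_dist z w : `|normc z - normc w| <= normc (z - w).
Proof.
have tri z' w' : normc z' - normc w' <= normc (z' - w').
  by rewrite lerBlDr -{1}(subrK w' z') le_normcD.
by rewrite ler_norml tri lerNl opprB -[normc (z - w)]normcN opprB tri.
Qed.

Lemma continuous_normcB z : continuous (fun w : C^o => normc (z - w) : R).
Proof.
move=> w; apply/(@cvgrPdist_lt _ _ _ _ (nbhs_filter (w : C^o))) => e e0.
have e0C : 0 < e%:C by rewrite ltcR.
have : \forall w' \near (w : C^o), `|w - w'| < e%:C.
  by exists e%:C.
apply: filterS => w'; rewrite norm_normc ltcR => ww.
apply: le_lt_trans (ler_normc_dist _ _) _.
by rewrite -normcN (_ : - _ = w - w') //; ring.
Qed.

End NormC.

Section LogKernel.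
Variable R : realType.
Local Notation C := R[i].
Variables (z : C) (d : R).
Hypotheses (d0 : 0 < d) (d3 : d <= 3).

(* Truncating at [d] makes [log (3 / |z - w|)] an admissible test function. The
   cap at 3 is harmless, as [|z - w| <= 2] for [z] on the circle and [w] an
   eigenvalue. *)
Definition logker (w : C) : R := ln 3 - ln (Num.max d (Num.min 3 (normc (z - w)))).

Let arg_gt0 w : 0 < Num.max d (Num.min 3 (normc (z - w))).
Proof. by rewrite lt_max d0. Qed.

Lemma logker_ge0 w : 0 <= logker w.
Proof.
rewrite subr_ge0 ler_ln ?posrE //.
by rewrite ge_max d3 ge_min lexx.
Qed.

Lemma logker_le w : logker w <= ln 3 - ln d.
Proof. by rewrite lerD2l lerN2 ler_ln ?posrE // le_max lexx. Qed.

Lemma logker_far w : 0 < normc (z - w) <= 3 -> logker w <= ln 3 - ln (normc (z - w)).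
Proof.
move=> /andP[n0 n3]; rewrite lerD2l lerN2 ler_ln ?posrE // le_max.
by rewrite le_min n3 lexx orbT.
Qed.

Lemma logker_near w : normc (z - w) <= d -> logker w = ln 3 - ln d.
Proof.
move=> nd; congr (_ - ln _); apply/max_idPl.
by rewrite ge_min nd orbT.
Qed.

Lemma continuous_logker : continuous (logker : C^o -> R).
Proof.
pose h (t : R) := ln 3 - ln (Num.max d (Num.min 3 t)).
have ch : continuous h.
  move=> t; apply: cvgB; first exact: cvg_cst.
  apply: continuous_cvg; first by apply: continuous_ln; rewrite lt_max d0.
  apply: (@continuous_max R R (cst d) (fun t => Num.min 3 t)).
    exact: cvg_cst.
  apply: (@continuous_min R R (cst 3) id); last exact: cvg_id.
  exact: cvg_cst.
move=> w.
exact: (@continuous_comp C^o R R (fun w => normc (z - w)) h w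
  (@continuous_normcB R z w) (@ch _)).
Qed.

Lemma bounded_logker : bounded_fun (logker : C^o -> R).
Proof.
exists (ln 3 - ln d); split; first by rewrite num_real.
move=> M dM w _ /=; rewrite ger0_norm ?logker_ge0 //.
exact: le_trans (logker_le w) (ltW dM).
Qed.

Lemma measurable_logker : measurable_fun setT (EFin \o logker : borel C^o -> \bar R).
Proof.
by apply/measurable_EFinP; apply: continuous_borel; exact: continuous_logker.
Qed.

(** Markov's inequality: the kernel is nonnegative and takes its largest value on [A]. *)
Lemma integral_logker_ge (nu : {measure set (borel C^o) -> \bar R})
    (A : set (borel C^o)) : measurable A -> (forall w, A w -> normc (z - w) <= d) ->
  ((ln 3 - ln d)%:E * nu A <= \int[nu]_w (logker w)%:E)%E.
Proof.
move=> mA Ad; rewrite -integral_cst //.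
apply: (@le_trans _ _ (\int[nu]_(w in A) (logker w)%:E)%E).
  rewrite le_eqVlt; apply/orP; left; apply/eqP.
  by apply: eq_integral => w /set_mem/Ad/logker_near ->.
apply: ge0_subset_integral => //; first exact: measurable_logker.
by move=> w _; rewrite lee_fin logker_ge0.
Qed.

Lemma integral_counting_measure E n :
  (\int[counting_measure E n]_w (logker w)%:E =
   ((n.*2.+1)%:R^-1 * \sum_(w <- eigenvalues (dirichlet E n)) logker w)%:E)%E.
Proof.
have k0 : forall w : borel C^o, [set: borel C^o] w -> (0 <= (EFin \o logker) w)%E.
  by move=> w _; rewrite lee_fin logker_ge0.
rewrite /counting_measure (ge0_integral_mscale _ measurableT _ measurable_logker k0).
rewrite (ge0_integral_measure_sum _ measurableT k0 measurable_logker).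
rewrite EFinM; congr (_ * _)%E.
rewrite [in RHS](big_nth 0) size_eigenvalues big_mkord -sumEFin.
apply: eq_bigr => i _; rewrite (integral_dirac _ measurableT measurable_logker).
by rewrite diracT mul1e.
Qed.

End LogKernel.

(** * Uniform bound on the potentials and passage to the weak limit *)

Section DensityOfStates.
Variable R : realType.
Local Notation C := R[i].
Variables (alpha lambda : int -> C) (c : R).
Hypotheses (lambda1 : forall k, `|lambda k| = 1).
Hypotheses (alphac : forall k, `|alpha k| <= c%:C) (c1 : c < 1).

Lemma prod_eigenvalues_ge n z : 1 <= normc z ->
  (1 - c) ^+ n.*2.+1 <=
    \prod_(w <- eigenvalues (dirichlet (pCMV alpha lambda) n)) normc (z - w).
Proof.
move=> z1; rewrite -normc_prod -lecR -norm_normc prod_eigenvalues.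
rewrite rmorphXn rmorphB rmorph1; apply: norm_det_dirichlet_ge => //.
  by rewrite -[1]/(1%:C) ltcR.
by rewrite norm_normc -[1]/(1%:C) lecR.
Qed.

(** At [z = w] the product of the distances to the eigenvalues vanishes, against the positive lower
    bound valid for [normc z >= 1]. *)
Lemma eigenvalue_lt1 n w :
  w \in eigenvalues (dirichlet (pCMV alpha lambda) n) -> normc w < 1.
Proof.
move=> wE; rewrite ltNge; apply/negP => /(prod_eigenvalues_ge n).
rewrite leNgt => /negP; apply.
rewrite (_ : \prod_(_ <- _) _ = 0) ?exprn_gt0 ?subr_gt0 //.
apply/eqP; rewrite prodf_seq_eq0; apply/hasP; exists w => //=.
by rewrite subrr ComplexField.Normc.normc0.
Qed.

Lemma integral_logker_counting_le z d n : normc z = 1 -> 0 < d -> d <= 3 ->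
  (\int[counting_measure (pCMV alpha lambda) n]_w (logker z d w)%:E <=
   (ln 3 - ln (1 - c))%:E)%E.
Proof.
move=> z1 d0 d3; rewrite integral_counting_measure // lee_fin mulrC ler_pdivrMr //.
set s := eigenvalues _.
have zs w : w \in s -> 0 < normc (z - w) <= 3.
  move=> /eigenvalue_lt1 w1; apply/andP; split.
    have := ler_normc_dist z w; apply: lt_le_trans.
    by rewrite normr_gt0 z1 subr_eq0 gt_eqF.
  by rewrite (le_trans (le_normcD _ _)) // normcN z1; lra.
have c10 : 0 < 1 - c by rewrite subr_gt0.
(* Without the truncation the kernel can only grow, and its sum becomes the logarithm of the product
   in [prod_eigenvalues_ge]. *)
apply: (@le_trans _ _ (\sum_(w <- s) (ln 3 - ln (normc (z - w))))).
  by rewrite big_seq [leRHS]big_seq; apply: ler_sum => w /zs; apply: logker_far.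
rewrite sumrB big_const_seq count_predT iter_addr_0 size_eigenvalues.
rewrite mulrBl mulr_natr lerB // mulr_natr -lnXn //.
have -> : \sum_(w <- s) ln (normc (z - w)) = ln (\prod_(w <- s) normc (z - w)).
  elim: s zs => [|w s IH] zs; first by rewrite !big_nil ln1.
  have /andP[w0 _] := zs _ (mem_head w s).
  rewrite !big_cons IH => [|v vs]; last by apply: zs; rewrite inE vs orbT.
  rewrite lnM ?posrE // big_seq prodr_gt0 // => v vs.
  by have /andP[] := zs v (mem_behead (s := w :: s) vs).
rewrite ler_ln ?posrE ?exprn_gt0 //; first by apply: prod_eigenvalues_ge; rewrite z1.
by apply: lt_le_trans (prod_eigenvalues_ge n _); rewrite ?exprn_gt0 ?z1.
Qed.

Lemma dos_measure_near (nu : {measure set (borel C^o) -> \bar R}) z d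
    (A : set (borel C^o)) :
  is_dos_measure (pCMV alpha lambda) nu -> normc z = 1 -> 0 < d -> d <= 3 ->
  measurable A -> (forall w, A w -> normc (z - w) <= d) ->
  ((ln 3 - ln d)%:E * nu A <= (ln 3 - ln (1 - c))%:E)%E.
Proof.
move=> dos z1 d0 d3 mA Ad; have H := @integral_logker_ge R z d d0 d3 nu A mA Ad.
apply: le_trans H _.
have lim := dos _ (@continuous_logker R z d d0) (@bounded_logker R z d d0 d3).
rewrite -(cvg_lim (@ereal_hausdorff _) lim); apply: lime_le; first exact: cvgP lim.
by apply: nearW => n; apply: integral_logker_counting_le.
Qed.

End DensityOfStates.

(** * Arcs *)

Section Arcs.
Variable R : realType.
Local Notation C := R[i].

(* An interval is the union of its subintervals with rational endpoints and of
   its extremal points. *)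
Lemma interval_image_borel (T : ptopologicalType) (f : R -> T) (I : set R) :
  hausdorff_space T -> continuous f -> is_interval I ->
  measurable (f @` I : set (borel T)).
Proof.
move=> hT cf itvI.
pose lo := [set x | I x /\ forall y, I y -> x <= y].
pose hi := [set x | I x /\ forall y, I y -> y <= x].
pose F (p q : rat) := if `[< I (ratr p) /\ I (ratr q) >]
  then `[ratr p, ratr q]%classic else set0 : set R.
have -> : I = (\bigcup_p \bigcup_q F p q) `|` (lo `|` hi).
  apply/seteqP; split => [x Ix|x].
    have [/existsNP[y /not_implyP[Iy /negP]]|] :=
      pselect (~ forall y, I y -> x <= y); last first.
      by move=> /contrapT xlo; right; left.
    rewrite -ltNge => yx.
    have [/existsNP[y' /not_implyP[Iy' /negP]]|] :=
      pselect (~ forall y, I y -> y <= x); last first.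
      by move=> /contrapT xhi; right; right.
    rewrite -ltNge => xy'; left.
    have [p] := rat_in_itvoo yx; rewrite in_itv /= => /andP[yp px].
    have [q] := rat_in_itvoo xy'; rewrite in_itv /= => /andP[xq qy'].
    exists p => //; exists q => //; rewrite /F asboolT ?in_itv /= ?in_itv /=.
      by rewrite !ltW.
    split; [apply: (itvI y x) => //|apply: (itvI x y') => //].
    - by rewrite !ltW.
    - by rewrite !ltW.
  move=> [[p _ [q _]]|[[]|[]] //]; rewrite /F; case: asboolP => // -[Ip Iq] /=.
  by rewrite in_itv /=; apply: itvI.
have cmp A : compact A -> measurable (f @` A : set (borel T)).
  move=> cA; apply: closed_borel; apply: (compact_closed hT).
  by apply: continuous_compact => //; exact: continuous_subspaceT.
have sub1 A : is_subset1 A -> measurable (f @` A : set (borel T)).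
  move=> A1; have [->|/set0P[x Ax]] := eqVneq A set0; first by rewrite image_set0.
  have -> : A = [set x].
    by apply/seteqP; split => [y Ay|y ->] //; exact: A1.
  by apply: cmp; exact: compact_set1.
rewrite !image_setU !image_bigcup; apply: measurableU; last apply: measurableU.
- apply: bigcupT_measurable_rat => p; rewrite image_bigcup.
  apply: bigcupT_measurable_rat => q; rewrite /F; case: ifP => _.
    by apply: cmp; exact: segment_compact.
  by rewrite image_set0.
- apply: sub1 => x y [Ix xlo] [Iy ylo]; apply/eqP.
  by rewrite eq_le xlo // ylo.
- apply: sub1 => x y [Ix xlo] [Iy ylo]; apply/eqP.
  by rewrite eq_le xlo // ylo.
Qed.

(** The mean value theorem bounds each coordinate by [|s - t|]; this gives the factor [sqrt 2],
    rounded up to 2. *)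
Lemma cis_dist (s t : R) : normc (cis s - cis t) <= 2 * `|s - t|.
Proof.
wlog st : s t / s <= t.
  move=> H; have [/H //|/ltW/H] := leP s t.
  by rewrite -normcN opprB distrC.
have lip (f df : R -> R) : (forall x : R, is_derive x 1 f (df x)) -> continuous f ->
    (forall x, `|df x| <= 1) -> `|f s - f t| <= `|s - t|.
  move=> fd cf df1.
  have [x _ fE] := MVT_segment st (fun x _ => fd x) (continuous_subspaceT cf).
  by rewrite distrC fE normrM [leRHS]distrC ler_piMl.
have dcos := lip _ _ (@is_derive_cos R) (@continuous_cos R) _.
have dsin := lip _ _ (@is_derive_sin R) (@continuous_sin R) (@cos_max R).
have {}dcos : `|cos s - cos t| <= `|s - t|.
  by apply: dcos => x; rewrite normrN sin_max.
rewrite /cis; set a := cos s - _ in dcos; set b := sin s - _ in dsin.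
rewrite -[normc _]/(Num.sqrt (a ^+ 2 + b ^+ 2)).
rewrite -[leRHS]ger0_norm ?mulr_ge0 // -sqrtr_sqr ler_wsqrtr //.
rewrite -[a ^+ 2]real_normK ?num_real // -[b ^+ 2]real_normK ?num_real //.
have da : `|a| ^+ 2 <= `|s - t| ^+ 2 by rewrite lerXn2r ?nnegrE.
have db : `|b| ^+ 2 <= `|s - t| ^+ 2 by rewrite lerXn2r ?nnegrE.
have := sqr_ge0 `|s - t|; rewrite exprMn; lra.
Qed.

Lemma normc_cis (t : R) : normc (cis t) = 1.
Proof. by rewrite /cis /= cos2Dsin2 sqrtr1. Qed.

Lemma continuous_cis : continuous (@cis R : R -> C^o).
Proof.
move=> t; apply/(@cvgrPdist_lt _ _ _ _ (nbhs_filter t)) => e e0.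
(* The norm of [C^o] takes values in [C], so the radius [e] is a complex number; being positive, it
   is real. *)
have /complex_realP[r er] : e \is Num.real by apply: gtr0_real.
rewrite {e}er in e0 *; have r0 : 0 < r by rewrite -ltcR.
have r20 : 0 < r / 2 by rewrite divr_gt0.
exists (r / 2) => //= s /= ts.
rewrite -[X in X < _]/((normc (cis t - cis s))%:C) ltcR.
by apply: le_lt_trans (cis_dist t s) _; rewrite mulrC -ltr_pdivlMr.
Qed.

Lemma cisD2pi (t : R) (k : int) : cis (t + 2 * pi * k%:~R) = cis t.
Proof.
have nat n x : cis (x + 2 * pi * n%:R) = cis x :> C.
  rewrite (_ : 2 * pi * n%:R = pi *+ 2 *+ n); last by rewrite -mulr_natr; ring.
  by rewrite /cis (periodicn (@cosD2pi R)) (periodicn (@sinD2pi R)).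
case: k => n; first exact: nat.
rewrite -[LHS](nat n.+1) NegzE mulrNz; congr cis.
by rewrite mulrN -pmulrn subrK.
Qed.

(** [Leb] sees only the angles in [[0, 2 * pi[]. A multiple of [2 * pi] moves [s] there; if the
    moved interval overshoots, its end is wrapped around to 0, and the two pieces are disjoint
    because [t - s <= 2 * pi]. *)
Lemma Leb_ge (A : set C) (s t : R) : s <= t -> t - s <= 2 * pi ->
  @cis R @` `[s, t] `<=` A -> ((t - s)%:E <= Leb A)%E.
Proof.
move=> st ts2 stA; set T := 2 * pi in ts2 *.
have T0 : 0 < T by rewrite mulr_gt0 ?pi_gt0.
pose k := Num.floor (s / T); pose s' := s - T * k%:~R; pose t' := t - T * k%:~R.
have tsE : t - s = t' - s' by rewrite /t' /s'; ring.
have A' x : s' <= x <= t' -> A (cis x).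
  move=> /andP[sx xt]; rewrite -(cisD2pi x k); apply: stA => /=.
  exists (x + 2 * pi * k%:~R) => //; rewrite in_itv /= -/T.
  by rewrite -lerBlDr sx -lerBrDr.
have s'0 : 0 <= s'.
  by rewrite subr_ge0 mulrC -ler_pdivlMr // floor_le.
have s'T : s' < T.
  have := floorD1_gt (s / T); rewrite ltr_pdivrMr // intrD -/k => sk.
  by rewrite /s' ltrBlDr (lt_le_trans sk) // mulrDl mul1r addrC mulrC.
(* [A] is arbitrary here, so monotonicity is taken from the outer measure. *)
have mono B : B `<=` `[0, T[ `&` @cis R @^-1` A -> (lebesgue_measure B <= Leb A)%E.
  by move=> BA; exact: (@le_mu_ext _ _ R (wlength idfun) B _ BA).
have [t'T|Tt'] := leP t' T.
  apply: le_trans (mono `[s', t'[%classic _).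
    rewrite lebesgue_measure_itv /= lte_fin.
    by case: ltP => h; rewrite -?EFinB lee_fin; lra.
  move=> x /=; rewrite in_itv /= => /andP[sx xt]; split => /=.
    by rewrite in_itv /=; lra.
  by apply: A'; rewrite sx ltW.
apply: le_trans (mono (`[s', T[%classic `|` `[0, t' - T[%classic) _).
  rewrite measureU //=.
  - rewrite !lebesgue_measure_itv /= !lte_fin s'T subr_gt0 Tt'.
    by rewrite -!EFinD lee_fin tsE; lra.
  - apply/seteqP; split => x //= -[]; rewrite !in_itv /=; lra.
move=> x /= []; rewrite in_itv /= => /andP[sx xt]; split => /=.
- by rewrite in_itv /=; lra.
- by apply: A'; lra.
- by rewrite in_itv /=; lra.
- by rewrite -(cisD2pi x 1) -/T mulr1; apply: A'; lra.
Qed.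

(** The part of the arc between two of its points has length at most [Leb A], and [cis_dist] turns
    length into distance. *)
Lemma arc_diameter (A : set C) z w : is_arc A -> (Leb A < (1 / 2)%:E)%E ->
  A z -> A w -> normc (z - w) <= 2 * fine (Leb A).
Proof.
move=> [I itvI AE] A1 Az Aw.
have Leb0 : (0 <= Leb A)%E by exact: measure_ge0.
have LebE : Leb A = (fine (Leb A))%:E.
  by rewrite fineK // ge0_fin_numE // (lt_trans A1) // ltry.
rewrite LebE lte_fin in A1.
suff main s t : I s -> I t -> s <= t ->
    normc (cis s - cis t) <= 2 * fine (Leb A).
  move: Az Aw; rewrite {1 2}AE => -[s Is <-] [t It <-].
  have [|/ltW ts] := leP s t; first exact: main.
  by rewrite -normcN opprB; exact: main.
move=> Is It st.
have sub r : r <= t -> @cis R @` `[s, r] `<=` A.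
  move=> rt y [x /=]; rewrite in_itv /= => /andP[sx xr] <-; rewrite AE.
  by exists x => //; apply: (itvI s t); rewrite ?sx ?(le_trans xr).
have [ts|ts] := leP (t - s) (2 * pi).
  have := Leb_ge st ts (sub t (lexx t)); rewrite LebE lee_fin => tsl.
  apply: le_trans (cis_dist s t) _; rewrite ler_wpM2l //.
  by rewrite distrC ger0_norm ?subr_ge0.
(* Otherwise [A] contains a full turn, of length [2 * pi], against [Leb A < 1 / 2]. *)
have := @Leb_ge A s (s + 2 * pi); rewrite LebE lee_fin.
have pi2 := pi_ge2 R.
by move=> /(_ _ _ (sub _ _)); rewrite addrAC subrr add0r => H; have := H _ _ _; lra.
Qed.

Lemma arc_borel (A : set C) : is_arc A -> measurable (A : set (borel C^o)).
Proof.
move=> [I itvI ->]; apply: (@interval_image_borel C^o) => //.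
exact: continuous_cis.
Qed.

Lemma arc_circle (A : set C) z : is_arc A -> A z -> normc z = 1.
Proof. by move=> [I _ ->] [t _ <-]; exact: normc_cis. Qed.

End Arcs.

(** * Generic realizations and the modulus of continuity *)

Lemma negligible_preimage (d : measure_display) (T : measurableType d)
    (R : realType) (mu : {measure set T -> \bar R}) (S : T -> T) :
  measurable_fun setT S ->
  (forall A, measurable A -> mu (S @^-1` A) = mu A) ->
  forall B, mu.-negligible B -> mu.-negligible (S @^-1` B).
Proof.
move=> mS muS B [N [mN N0 BN]]; exists (S @^-1` N); split.
- by rewrite -[X in measurable X]setTI; exact: mS.
- by rewrite muS.
- by move=> x; exact: BN.
Qed.

Lemma ae_iterz (d : measure_display) (T : measurableType d)
    (R : realType) (mu : {measure set T -> \bar R}) (S S' : T -> T) (P : T -> Prop) :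
  cancel S S' -> measurable_fun setT S -> measurable_fun setT S' ->
  (forall A, measurable A -> mu (S @^-1` A) = mu A) ->
  {ae mu, forall w, P w} -> {ae mu, forall w, forall n : int, P (iterz S S' n w)}.
Proof.
move=> SK mS mS' muS PB.
have muS' A : measurable A -> mu (S' @^-1` A) = mu A.
  move=> mA; rewrite -muS; last by rewrite -[X in measurable X]setTI; exact: mS'.
  by rewrite -comp_preimage (_ : S' \o S = id) //; apply/funext.
have iterN F : (forall B, mu.-negligible B -> mu.-negligible (F @^-1` B)) ->
    forall k, mu.-negligible (~` [set w | P (iter k F w)]).
  move=> nF; elim=> [|k IH]; first exact: PB.
  have := nF _ IH; congr (mu.-negligible _); apply/funext => w /=.
  by rewrite /preimage /= -iterSr.
have N1 := negligible_bigcup (iterN S (negligible_preimage mS muS)).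
have N2 := negligible_bigcup (iterN S' (negligible_preimage mS' muS')).
apply: negligibleS (negligibleU N1 N2) => w /= /existsNP[[k|k] Pk].
- by left; exists k.
- by right; exists k.+1.
Qed.

Lemma ae_exists (d : measure_display) (T : measurableType d)
    (R : realType) (mu : probability T R) (P Q : T -> Prop) :
  {ae mu, forall w, P w} -> {ae mu, forall w, Q w} -> exists w, P w /\ Q w.
Proof.
move=> mP mQ; apply: contrapT => /forallNP PQ.
have [N [mN N0 TN]] := negligibleU mP mQ.
have : (mu setT <= mu N)%E.
  apply: le_measure; rewrite ?inE // => w _; apply: TN.
  by have /not_andP[] := PQ w; [left|right].
by rewrite N0 probability_setT lee_fin ler10.
Qed.

(** For [l > 0] the choice [d = 2 * l] works: [ln 3 - ln (2 * l)] is at least [- ln l] because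
    [ln 2 <= ln 3]. *)
Lemma le_div_ln (R : realType) (x : \bar R) (c l : R) :
  (0 <= x)%E -> 0 <= c -> 0 <= l -> l < 1 / 2 ->
  (forall d, 0 < d -> d <= 3 -> 2 * l <= d ->
    ((ln 3 - ln d)%:E * x <= c%:E)%E) ->
  (x <= (- c / ln l)%:E)%E.
Proof.
move=> x0 c0 l0 l12 xc.
have ln3 : 0 < ln 3 :> R by rewrite ln_gt0 ?ltr1n.
case: x x0 xc => [r||//] r0 rc; last first.
  (* An infinite [x] is excluded by [d = 1]. *)
  have l21 : 2 * l <= 1 by lra.
  have := rc 1 ltr01 (ler1n _ 3) l21.
  by rewrite ln1 subr0 gt0_muley ?lte_fin // leye_eq.
rewrite lee_fin in r0.
have {}rc d : 0 < d -> d <= 3 -> 2 * l <= d -> (ln 3 - ln d) * r <= c.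
  by move=> d0 d3 ld; have := rc d d0 d3 ld; rewrite -EFinM lee_fin.
have [l_0|l_neq0] := eqVneq l 0.
  (* Here [ln 0 = 0] and [0^-1 = 0] make the bound 0. If [r > 0], then [d = expR (- (c / r))] would
     give [ln 3 * r + c <= c]. *)
  rewrite [in leRHS]l_0 ln0 // invr0 mulr0 lee_fin leNgt; apply/negP => r_gt0.
  have cr : 0 <= c / r by rewrite divr_ge0.
  have e1 : expR (- (c / r)) <= 1 by rewrite -expR0 ler_expR oppr_le0.
  have e3 : expR (- (c / r)) <= 3 by lra.
  have := rc _ (expR_gt0 _) e3.
  rewrite expRK opprK l_0 mulr0 => /(_ (expR_ge0 _)).
  rewrite mulrDl divfK ?gt_eqF //.
  by have := mulr_gt0 ln3 r_gt0; lra.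
have lgt0 : 0 < l by rewrite lt0r l_neq0.
have lnl : ln l < 0 by rewrite ln_lt0 // lgt0 /=; lra.
have ln23 : ln 2 <= ln 3 :> R by rewrite ler_ln ?posrE // ler_nat.
rewrite lee_fin mulNr -mulrN -invrN ler_pdivlMr ?oppr_gt0 //.
have l2_gt0 : 0 < 2 * l by lra.
have l2_le3 : 2 * l <= 3 by lra.
have := rc _ l2_gt0 l2_le3 (lexx _); rewrite lnM ?posrE //; apply: le_trans.
by rewrite mulrC ler_wpM2r //; lra.
Qed.

Theorem theorem2p4 (R : realType) (Omega : ptopologicalType)
    (mu : probability (borel Omega) R)
    (S S' : borel Omega -> borel Omega)
    (SK : cancel S S') (S'K : cancel S' S)
    (mS : measurable_fun setT S) (mS' : measurable_fun setT S')
    (ergS : ergodic mu S)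
    (f g : borel Omega -> borel R[i]^o)
    (mf : measurable_fun setT f) (mg : measurable_fun setT g)
    (f_disk : forall w, `|f w : R[i]| < 1)
    (g_circle : forall w, `|g w : R[i]| = 1)
    (c0 : R) (c0_lt1 : c0 < 1)
    (f_bound : {ae mu, forall w, `|f w : R[i]| <= c0%:C})
    (nu : {measure set (borel R[i]^o) -> \bar R})
    (nu_dos : {ae mu, forall w,
       is_dos_measure (pCMV (fun n => f (iterz S S' n w))
                            (fun n => g (iterz S S' n w))) nu}) :
  exists2 c : R, 0 < c &
    forall A : set R[i], is_arc A -> (Leb A < (1 / 2)%:E)%E ->
      (nu A <= (- c * (ln (fine (Leb A)))^-1)%:E)%E.
Proof.
have [_ muS _] := ergS.
(* [nu] is shared by almost all realizations, so it can be studied on one whose coefficients are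
   bounded by [c0] along the whole orbit. *)
have [w [fw dos]] := ae_exists (ae_iterz SK mS mS' muS f_bound) nu_dos.
have c00 : 0 <= c0 by rewrite -ler0c; apply: le_trans (fw 0).
have ln3 : 0 < ln 3 :> R by rewrite ln_gt0 ?ltr1n.
exists (ln 3 - ln (1 - c0)).
  by rewrite (lt_le_trans ln3) // lerDl oppr_ge0 ln_le0 // gerBl.
set c := ln 3 - _ => A arcA A1.
have Leb0 : (0 <= Leb A)%E by exact: measure_ge0.
have LebE : Leb A = (fine (Leb A))%:E.
  by rewrite fineK // ge0_fin_numE // (lt_trans A1) // ltry.
set l := fine (Leb A) in LebE *.
have l0 : 0 <= l by rewrite -lee_fin -LebE.
have l1 : l < 1 / 2 by rewrite -lte_fin -LebE.
apply: le_div_ln => //; first by rewrite subr_ge0 ler_ln ?posrE ?subr_gt0 //; lra.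
move=> d d0 d3 ld.
(* Any point of [A] can serve as the centre of the disk, which leaves the empty arc apart. *)
have [->|/set0P[z Az]] := eqVneq A set0.
  by rewrite measure0 mule0 lee_fin /c subr_ge0 ler_ln ?posrE ?subr_gt0 //; lra.
apply: (dos_measure_near (fun k => g_circle _) fw c0_lt1 dos
  (arc_circle arcA Az) d0 d3 (arc_borel arcA)) => v Av.
exact: le_trans (arc_diameter arcA A1 Az Av) ld.
Qed.
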